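(* Let $A\in\mathbb{R}^{N\times N}$ be symmetric and $B\in\{0,1\}^{N\times M}$, with clusters $\mathcal{C}_1,\dots,\mathcal{C}_K$ and with $T_{or}$, $A_{\perp}$, $\Lambda^{\perp}$ and $\Omega_i^j$ as defined in the context. If $D\in\mathbb{R}^{N\times W}$ solves Problem 1, i.e., $D_{\parallel}=0$ and $(A_{\perp},D_{\perp})$ is stabilizable, then the number of rows of $D$ with at least one nonzero entry is lower bounded by $$\sum_{j=1}^{K}\left(\max_{i:\lambda_i\in\Lambda^{\perp}}|\Omega_i^j|_{\emptyset}+1\right).$$
   Context: $\mathrm{aut}(\mathcal{G}(A,B))$ is the group of $N\times N$ permutation matrices $P$ with $PA=AP$ and $PB=B$, acting on the node set $\{1,\dots,N\}$; its orbits (clusters) $\mathcal{C}_1,\dots,\mathcal{C}_K$ partition the nodes. The group consensus subspace is $\mathcal{X}_{or}=\{x\in\mathbb{R}^N:\ x_i=x_l\ \forall i,l\in\mathcal{C}_j,\ \forall j\}$; it is $A$-invariant. $T_{or}=\begin{bmatrix} T^{\parallel} \\ T^{\perp} \end{bmatrix}\in\mathbb{R}^{N\times N}$ is an orthogonal matrix (the irreducible-representation transformation) with $T^{\parallel}\in\mathbb{R}^{K\times N}$, $T^{\parallel}_{ij}=|\mathcal{C}_i|^{-1/2}$ if $j\in\mathcal{C}_i$ and $0$ otherwise; the rows of $T^{\perp}\in\mathbb{R}^{(N-K)\times N}$ form a basis of the orthogonal complement of $\mathcal{X}_{or}$, and each row of $T^{\perp}$ has nonzero entries only at nodes of a single cluster.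 One has $T_{or}AT_{or}^T=\begin{bmatrix} A_{\parallel} & 0 \\ 0 & A_{\perp} \end{bmatrix}$. The network with additional inputs $w\in\mathbb{R}^W$ is $\dot x=Ax+Bu+Dw$ with $D\in\mathbb{R}^{N\times W}$; $D_{\parallel}=T^{\parallel}D$ and $D_{\perp}=T^{\perp}D$. Problem 1: select $D$ such that $D_{\parallel}=0$ and $(A_{\perp},D_{\perp})$ is stabilizable (usual continuous-time sense; eigenvalues with nonnegative real part count as unstable). The nodes whose rows of $D$ have a nonzero entry are the drivers. $\Lambda^{\perp}$ is the set of eigenvalues $\lambda_i$ of $A$ with nonnegative real part that are also eigenvalues of $A_{\perp}$. For $\lambda_i\in\Lambda^{\perp}$, $\Omega_i$ is the subspace of the eigenspace of $A$ for $\lambda_i$ consisting of vectors orthogonal to $\mathcal{X}_{or}$. For $j=1,\dots,K$, $\Omega_i^j$ is the $j$-th cluster-specific subspace of $\Omega_i$: the subspace spanned by the vectors of $\Omega_i$ whose $m$-th entry is nonzero only if node $m$ belongs to $\mathcal{C}_j$. $|\Omega_i^j|$ denotes the dimension of $\Omega_i^j$. The operator $|\cdot|_{\emptyset}$ equals $|\cdot|$ if $|\cdot|>0$ and equals $-1$ otherwise. The maximum of $|\Omega_i^j|_\emptyset$ over an empty $\Lambda^{\perp}$ is taken to be $-1$. *)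

(* Defs.v *)
(* Mathematical Components, with the reals given by an arbitrary realType.
   Vectors of R^N are row vectors; a subspace of R^N is the row space of a
   matrix (scope %MS), so membership is (v <= S)%MS and dimension is \rank S. *)
From mathcomp Require Import all_boot all_order all_algebra all_fingroup.
From mathcomp Require Import reals.
From mathcomp Require Import polyrcf complex.

Set Implicit Arguments.
Unset Strict Implicit.
Unset Printing Implicit Defensive.

Import Order.TTheory GRing.Theory Num.Theory GroupScope.
Local Open Scope ring_scope.

Section Network.
Variables (R : realType) (N M : nat) (A : 'M[R]_N) (B : 'M[R]_(N, M)).

(* The permutation matrix P is encoded as perm_mx s. *)
Definition aut : {set 'S_N} :=
  [set s : 'S_N | (perm_mx s *m A == A *m perm_mx s)
                  && (perm_mx s *m B == B)].

Lemma aut_group_set : group_set aut.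
Proof.
apply/group_setP; split=> [|s t].
  by rewrite inE perm_mx1 !mul1mx mulmx1 !eqxx.
rewrite !inE => /andP[/eqP sA /eqP sB] /andP[/eqP tA /eqP tB].
rewrite !perm_mxM -!mulmxA tA tB sB eqxx andbT.
by rewrite !mulmxA sA.
Qed.
Canonical aut_group := Group aut_group_set.

Definition clusters : {set {set 'I_N}} := orbit 'P aut @: [set: 'I_N].

Lemma partition_clusters : partition clusters [set: 'I_N].
Proof.
apply: (@orbit_partition _ _ _ 'P%act aut_group).
by apply/actsP=> s _ i; rewrite !inE.
Qed.

Definition nclusters : nat := #|clusters|.

Definition cluster (j : 'I_nclusters) : {set 'I_N} := enum_val j.

Definition linked (i l : 'I_N) : bool :=
  [exists j, (i \in cluster j) && (l \in cluster j)].

(* delta_mx i 0 - delta_mx l 0 is the linear form v |-> v_i - v_l. *)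
Definition consensus : 'M[R]_N :=
  (\bigcap_(p : 'I_N * 'I_N | linked p.1 p.2)
     kermx (delta_mx p.1 0 - delta_mx p.2 0 : 'cV[R]_N))%MS.

Lemma mul_delta (v : 'rV[R]_N) (i : 'I_N) :
  v *m (delta_mx i 0 : 'cV[R]_N) = (v 0 i)%:M.
Proof. by rewrite -colE; apply/rowP=> k; rewrite !mxE !ord1 eqxx. Qed.

Lemma consensusP (v : 'rV[R]_N) :
  reflect (forall j i l, i \in cluster j -> l \in cluster j -> v 0 i = v 0 l)
          (v <= consensus)%MS.
Proof.
apply: (iffP sub_bigcapmxP) => [H j i l ij lj|H [i l] /existsP[j /andP[ij lj]]].
  have /sub_kermxP: (v <= kermx (delta_mx i 0 - delta_mx l 0 : 'cV[R]_N))%MS.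
    by apply: (H (i, l)); apply/existsP; exists j; rewrite ij.
  rewrite mulmxBr !mul_delta => /matrixP/(_ 0 0)/eqP.
  by rewrite !mxE /= !mulr1n subr_eq0 => /eqP.
by apply/sub_kermxP; rewrite mulmxBr !mul_delta (H j i l) ?subrr.
Qed.

Definition ortho_consensus : 'M[R]_N := kermx consensus^T.

Lemma ortho_consensusP (v : 'rV[R]_N) :
  reflect (forall x : 'rV[R]_N, (x <= consensus)%MS ->
             \sum_i v 0 i * x 0 i = 0)
          (v <= ortho_consensus)%MS.
Proof.
have dotE (x : 'rV[R]_N) : v *m x^T = (\sum_i v 0 i * x 0 i)%:M.
  by apply/rowP=> k; rewrite !mxE !ord1 eqxx; apply: eq_bigr => i _; rewrite mxE.
apply: (iffP sub_kermxP) => [H x /submxP[y ->]|H].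
  have := dotE (y *m consensus); rewrite trmx_mul mulmxA H mul0mx.
  by move=> /matrixP/(_ 0 0); rewrite !mxE eqxx mulr1n => <-.
apply/rowP=> k; have := dotE (row k consensus).
rewrite (H _ (row_sub _ _)) raddf0 => /matrixP/(_ 0 0).
rewrite !mxE => Hk; rewrite -[RHS]Hk.
by apply: eq_bigr => i _; rewrite !mxE.
Qed.

Definition Tpar : 'M[R]_(nclusters, N) :=
  \matrix_(j, i) (if i \in cluster j
                  then (Num.sqrt #|cluster j|%:R)^-1 else 0).

Definition Tor (Tperp : 'M[R]_(N - nclusters, N)) :
  'M[R]_(nclusters + (N - nclusters), N) := col_mx Tpar Tperp.

(* Tor is square only up to the equation nclusters + (N - nclusters) = N, so
   orthogonality is stated as both one-sided identities. *)
Definition irr_transformation (Tperp : 'M[R]_(N - nclusters, N)) : Prop :=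
  [/\ Tor Tperp *m (Tor Tperp)^T = 1%:M,
      (Tor Tperp)^T *m Tor Tperp = 1%:M,
      row_free Tperp,
      (Tperp == ortho_consensus)%MS
    & forall i, exists j, forall m, Tperp i m != 0 -> m \in cluster j].

Definition Aperp (Tperp : 'M[R]_(N - nclusters, N)) : 'M[R]_(N - nclusters) :=
  drsubmx (Tor Tperp *m A *m (Tor Tperp)^T).

Lemma AperpE (Tperp : 'M[R]_(N - nclusters, N)) :
  Aperp Tperp = Tperp *m A *m Tperp^T.
Proof.
by rewrite /Aperp /Tor tr_col_mx mul_col_mx mul_col_row block_mxKdr.
Qed.

(* Intended for symmetric A: its eigenvalues are then real and the same for row
   and column vectors, and having nonnegative real part reads 0 <= l. *)
Definition Lambda_perp (Tperp : 'M[R]_(N - nclusters, N)) : seq R :=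
  [seq l <- rootsR (char_poly A) | (0 <= l) && eigenvalue (Aperp Tperp) l].

Lemma mem_Lambda_perp (Tperp : 'M[R]_(N - nclusters, N)) (l : R) :
  (l \in Lambda_perp Tperp) =
  [&& eigenvalue A l, 0 <= l & eigenvalue (Aperp Tperp) l].
Proof.
rewrite mem_filter andbC; congr (_ && _).
have p0 : char_poly A != 0 by rewrite monic_neq0 ?char_poly_monic.
by rewrite eigenvalue_root_char -(roots_on_rootsR p0 l) in_itv.
Qed.

Definition Omega (l : R) : 'M[R]_N := (eigenspace A l :&: ortho_consensus)%MS.

Definition supported_on (C : {set 'I_N}) : 'M[R]_N :=
  (\bigcap_(m | m \notin C) kermx (delta_mx m 0 : 'cV[R]_N))%MS.

(* The vectors of Omega l supported on a cluster already form a subspace, so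
   their span is the intersection below. *)
Definition Omega_cluster (l : R) (j : 'I_nclusters) : 'M[R]_N :=
  (Omega l :&: supported_on (cluster j))%MS.

Lemma Omega_clusterP (l : R) (j : 'I_nclusters) (v : 'rV[R]_N) :
  reflect [/\ v *m A = l *: v, (v <= ortho_consensus)%MS
            & forall m, v 0 m != 0 -> m \in cluster j]
          (v <= Omega_cluster l j)%MS.
Proof.
rewrite !sub_capmx; apply: (iffP andP).
  move=> [/andP[/eigenspaceP-> ->] /sub_bigcapmxP H]; split=> // m.
  apply: contraNT => /H/sub_kermxP; rewrite mul_delta.
  by move=> /matrixP/(_ 0 0); rewrite !mxE eqxx mulr1n => ->.
move=> [/eigenspaceP-> -> H]; split=> //; apply/sub_bigcapmxP=> m mj.
apply/sub_kermxP; rewrite mul_delta; have [->|/H] := eqVneq (v 0 m) 0.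
  exact: raddf0.
by rewrite (negPf mj).
Qed.

End Network.

Definition dim_empty (d : nat) : int := if (0 < d)%N then d%:Z else -1.

(* The default -1 is the value of the maximum when Lambda_perp is empty; it is
   neutral otherwise, since dim_empty is bounded below by -1. *)
Definition max_dim_Omega (R : realType) (N M : nat) (A : 'M[R]_N)
    (B : 'M[R]_(N, M)) (Tperp : 'M[R]_(N - nclusters A B, N))
    (j : 'I_(nclusters A B)) : int :=
  \big[Order.max/-1]_(l <- Lambda_perp Tperp)
     dim_empty (\rank (Omega_cluster l j)).

(* Some static feedback makes every complex eigenvalue of the closed loop lie in
   the open left half-plane. *)
Definition stabilizable (R : realType) (n m : nat) (A : 'M[R]_n)
    (D : 'M[R]_(n, m)) : Prop :=
  exists F : 'M[R]_(m, n), forall z : R[i],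
    eigenvalue (map_mx (real_complex R) (A + D *m F)) z -> complex.Re z < 0.

Definition drivers (R : realType) (N W : nat) (D : 'M[R]_(N, W)) :
  {set 'I_N} := [set i | [exists k, D i k != 0]].

(* Main.v *)
Require Import Defs.
From mathcomp Require Import all_boot all_order all_algebra.
From mathcomp Require Import reals.
From mathcomp Require Import complex.

Set Implicit Arguments.
Unset Strict Implicit.
Unset Printing Implicit Defensive.

Import Order.TTheory GRing.Theory Num.Theory.
Local Open Scope ring_scope.

(** The clusters are disjoint, so the bound may be proved cluster by cluster.
    Fix a cluster C, an unstable eigenvalue l, and let V be the space of
    eigenvectors for l that are orthogonal to the consensus subspace and
    supported on C; suppose its dimension d is positive. Two facts about the
    rows of D indexed by C give d + 1 drivers in C.

    - v |-> v D is injective on V. An eigenvector v orthogonal to the consensus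
      subspace has the form v = w Tperp with w a left eigenvector of Aperp, and
      w (Tperp D) = v D. If v D = 0, then w is a left eigenvector of the closed
      loop for every feedback, so stabilizability excludes l >= 0
      (stabilizable_left_eigenvector and Omega_mul_eq0). As vectors of V vanish
      off C, the rows of D in C must therefore span a space of dimension at
      least d.

    - The condition Tpar D = 0 says that the rows of D in C add up to zero
      (sum_rows_cluster). So one nonzero row is redundant, and the rows in C
      span a space of dimension at most the number of drivers in C minus one
      (rank_rows_sum0). *)

(** The necessary half of the Popov-Belevitch-Hautus test, for real
    eigenvalues: a left eigenvector killed by the input matrix keeps its
    eigenvalue under every feedback. *)
Lemma stabilizable_left_eigenvector (R : realType) (n m : nat)
    (A : 'M[R]_n) (D : 'M[R]_(n, m)) (l : R) (w : 'rV[R]_n) :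
  stabilizable A D -> 0 <= l -> w *m A = l *: w -> w *m D = 0 -> w = 0.
Proof.
move=> [F stableF] l_ge0 wA wD; apply/eqP; apply: contraLR l_ge0 => w_neq0.
rewrite -ltNge; apply: (stableF (real_complex R l)).
apply/eigenvalueP; exists (map_mx (real_complex R) w); last by rewrite map_mx_eq0.
by rewrite -map_mxM mulmxDr mulmxA wD mul0mx addr0 wA map_mxZ.
Qed.

Lemma Tperp_orthonormal (R : realType) (N M : nat)
    (A : 'M[R]_N) (B : 'M[R]_(N, M)) (Tperp : 'M[R]_(N - nclusters A B, N)) :
  irr_transformation Tperp -> Tperp *m Tperp^T = 1%:M.
Proof.
move=> [+ _ _ _ _]; rewrite /Tor tr_col_mx mul_col_row scalar_mx_block.
by move=> /eq_block_mx[].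
Qed.

Lemma Omega_mul_eq0 (R : realType) (N M W : nat)
    (A : 'M[R]_N) (B : 'M[R]_(N, M)) (D : 'M[R]_(N, W))
    (Tperp : 'M[R]_(N - nclusters A B, N)) (l : R) (v : 'rV[R]_N) :
  irr_transformation Tperp -> stabilizable (Aperp Tperp) (Tperp *m D) ->
  0 <= l -> (v <= Omega A B l)%MS -> v *m D = 0 -> v = 0.
Proof.
move=> irrT stab l_ge0; rewrite sub_capmx => /andP[/eigenspaceP vA v_ortho] vD.
have [_ _ _ /eqmxP eqT _] := irrT.
move: v_ortho; rewrite -eqT => /submxP[w v_eq].
rewrite v_eq (_ : w = 0) ?mul0mx //.
apply: (stabilizable_left_eigenvector stab l_ge0); last by rewrite mulmxA -v_eq.
rewrite AperpE !mulmxA -v_eq vA -scalemxAl v_eq -mulmxA.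
by rewrite Tperp_orthonormal // mulmx1.
Qed.

Lemma sum_rows_cluster (R : realType) (N M W : nat)
    (A : 'M[R]_N) (B : 'M[R]_(N, M)) (D : 'M[R]_(N, W))
    (j : 'I_(nclusters A B)) :
  Tpar A B *m D = 0 -> \sum_(i in cluster j) row i D = 0.
Proof.
move=> TD; apply/rowP=> k; have /matrixP/(_ j k) := TD.
rewrite !mxE summxE; under eq_bigr => i _ do rewrite mxE (fun_if ( *%R^~ _)) mul0r.
rewrite -big_mkcond -mulr_sumr /= => /eqP.
under [in X in _ -> X]eq_bigr => i _ do rewrite mxE.
(* An empty cluster would make the normalizing factor of its row vanish, but
   then the sum is empty. *)
have [->|] := eqVneq (cluster j) set0; first by rewrite big_set0.
rewrite -card_gt0 => C_gt0; rewrite mulf_eq0 invr_eq0 sqrtr_eq0.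
by rewrite lern0 eqn0Ngt C_gt0 /= => /eqP.
Qed.

(** Discarding one nonzero row, which is minus the sum of the others, leaves
    a spanning family. *)
Lemma rank_rows_sum0 (R : realType) (N W d : nat) (D : 'M[R]_(N, W))
    (C : {set 'I_N}) (X : 'M[R]_(d, W)) :
  \sum_(i in C) row i D = 0 ->
  (X <= \sum_(i in C) <<row i D>>)%MS ->
  (\rank X <= #|drivers D :&: C|.-1)%N.
Proof.
move=> sumD XD; set S := drivers D :&: C.
have row0 i : i \notin drivers D -> row i D = 0.
  rewrite inE => /existsPn H; apply/rowP=> k; rewrite !mxE.
  by apply/eqP; have := H k; rewrite negbK.
have rankS (T : {set 'I_N}) : (\rank (\sum_(i in T) <<row i D>>)%MS <= #|T|)%N.
  rewrite -sum1_card; apply: (big_ind2 (fun (Y : 'M_W) s => \rank Y <= s)%N).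
  - by rewrite mxrank0.
  - by move=> Y1 s1 Y2 s2 H1 H2; apply: leq_trans (mxrank_adds_leqif _ _) (leq_add H1 H2).
  - by move=> i _; rewrite mxrank_gen rank_leq_row.
have sumS : \sum_(i in S) row i D = 0.
  rewrite -[RHS]sumD [RHS](bigID (mem (drivers D))) /=.
  rewrite [X in _ = _ + X]big1 => [|i /andP[_ /row0]//].
  by rewrite addr0; apply: eq_bigl => i; rewrite in_setI andbC.
have [S0|[i0 i0S]] := set_0Vmem S.
  rewrite S0 cards0 leqn0 mxrank_eq0 -submx0; apply: submx_trans XD _.
  apply/sumsmx_subP=> i iC; rewrite genmxE row0 ?sub0mx //.
  by apply: contraTN isT => iD; have := in_set0 i; rewrite -S0 in_setI iD iC.
rewrite (cardsD1 i0 S) i0S /=; apply: leq_trans (rankS _); apply: mxrankS.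
apply: submx_trans XD _; apply/sumsmx_subP=> i iC; rewrite genmxE.
have in_span k : k \in S :\ i0 ->
    (row k D <= \sum_(i in S :\ i0) <<row i D>>)%MS.
  by move=> kS; apply: (sumsmx_sup k); rewrite ?genmxE.
have [->|i_neq] := eqVneq i i0.
  move/eqP: sumS; rewrite (big_setD1 i0) //= addr_eq0 => /eqP ->.
  by rewrite eqmx_opp; apply: summx_sub.
have [iD|/row0->] := boolP (i \in drivers D); last exact: sub0mx.
by apply: in_span; rewrite !inE i_neq iC andbT; rewrite inE in iD.
Qed.

(** The truncated predecessor is the right form when the subspace is zero and
    the cluster may have no driver at all. *)
Lemma rank_Omega_cluster (R : realType) (N M W : nat)
    (A : 'M[R]_N) (B : 'M[R]_(N, M)) (D : 'M[R]_(N, W))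
    (Tperp : 'M[R]_(N - nclusters A B, N)) (l : R) (j : 'I_(nclusters A B)) :
  irr_transformation Tperp -> Tpar A B *m D = 0 ->
  stabilizable (Aperp Tperp) (Tperp *m D) -> 0 <= l ->
  (\rank (Omega_cluster l j) <= #|drivers D :&: cluster j|.-1)%N.
Proof.
move=> irrT TD stab l_ge0; set V := Omega_cluster l j.
have -> : \rank V = \rank (V *m D).
  apply/esym/mxrank_injP/rowV0P => v; rewrite sub_capmx.
  move=> /andP[vV /sub_kermxP vD].
  apply: (Omega_mul_eq0 irrT stab l_ge0 _ vD).
  exact: submx_trans vV (capmxSl _ _).
apply: rank_rows_sum0; first exact: sum_rows_cluster.
apply/row_subP=> i; rewrite row_mul mulmx_sum_row; apply: summx_sub => k _.
have [_ _ supp] := Omega_clusterP l j _ (row_sub i V).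
have [->|/supp kC] := eqVneq (row i V 0 k) 0; first by rewrite scale0r sub0mx.
by apply: scalemx_sub; apply: (sumsmx_sup k); rewrite ?genmxE.
Qed.

Lemma sum_card_cluster (R : realType) (N M : nat)
    (A : 'M[R]_N) (B : 'M[R]_(N, M)) (S : {set 'I_N}) :
  (\sum_(j < nclusters A B) #|S :&: cluster j| = #|S|)%N.
Proof.
rewrite -(big_enum_val (fun C : {set 'I_N} => #|S :&: C|)) /=.
rewrite -[RHS]sum1_card (eq_bigl (fun i => (i \in setT) && (i \in S))); last first.
  by move=> i; rewrite inE.
rewrite (set_partition_big_cond _ (partition_clusters A B)).
apply: eq_bigr => C _; rewrite -sum1_card; apply: eq_bigl => i.
by rewrite in_setI andbC.
Qed.

Theorem corollary5 (R : realType) (N M W : nat)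
    (A : 'M[R]_N) (B : 'M[R]_(N, M)) (D : 'M[R]_(N, W))
    (Tperp : 'M[R]_(N - nclusters A B, N)) :
  A^T = A ->
  (forall i k, B i k = 0 \/ B i k = 1) ->
  irr_transformation Tperp ->
  Tpar A B *m D = 0 ->
  stabilizable (Aperp Tperp) (Tperp *m D) ->
  \sum_(j < nclusters A B) (max_dim_Omega Tperp j + 1) <= #|drivers D|%:Z.
Proof.
move=> _ _ irrT TD stab.
rewrite -(sum_card_cluster A B) -natz natr_sum; apply: ler_sum => j _.
rewrite natz -lerBrDr /max_dim_Omega big_seq; set b := _%:Z - 1.
have b_ge : -1 <= b by rewrite /b lerBrDr addNr.
apply: (big_ind (fun m => m <= b)) => // [x y xb yb|l].
  by rewrite ge_max xb.
rewrite mem_Lambda_perp => /and3P[_ l_ge0 _].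
have := rank_Omega_cluster j irrT TD stab l_ge0; rewrite /dim_empty.
case: ltnP => // d_gt0 d_le; rewrite /b lerBrDr.
have S_gt0 : (0 < #|drivers D :&: cluster j|)%N.
  by rewrite lt0n; apply: contraTneq d_le => ->; rewrite -ltnNge.
by rewrite -PoszD addn1 lez_nat -(prednK S_gt0) ltnS.
Qed.
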